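(* Let $\mathfrak{h}(x)=\frac{1}{\log(1/x)}$. There exists a set $E\subseteq\mathbb{R}^2$ that is a Furstenberg set of type $\mathfrak{h}$ (an $F_{\mathfrak{h}}$-set) such that $\dim_H(E)\le \frac12$.
   Context: A dimension function is a non-decreasing, right continuous function $h:[0,\infty)\to[0,\infty)$ with $h(0)=0$. The function $\mathfrak{h}(x)=\frac{1}{\log(1/x)}$ is understood for small $x>0$, with $\mathfrak{h}(0)=0$, and extended in any way to a dimension function on $[0,\infty)$; only the behaviour near $0$ matters. For a dimension function $h$, a set $E\subseteq\mathbb{R}^n$ and $\delta>0$, put $$\mathcal{H}^h_\delta(E)=\inf\Big\{\sum_i h(\operatorname{diam}(E_i)) : E\subset\bigcup_i E_i,\ \operatorname{diam}(E_i)<\delta\Big\},$$ where the infimum is over countable covers, and $\mathcal{H}^h(E)=\sup_{\delta>0}\mathcal{H}^h_\delta(E)$. $\dim_H$ denotes Hausdorff dimension. For a dimension function $h$, a set $E\subseteq\mathbb{R}^2$ is a Furstenberg set of type $h$, or an $F_h$-set, if for each direction $e$ in the unit circle there is a line segment $\ell_e$ in the direction of $e$ such that $\mathcal{H}^h(\ell_e\cap E)>0$. *)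

(* Defs.v *)
From HB Require Import structures.
From mathcomp Require Import all_boot all_order all_algebra.
From mathcomp Require Import all_classical all_reals all_analysis.

Set Implicit Arguments.
Unset Strict Implicit.
Unset Printing Implicit Defensive.

Import Order.TTheory GRing.Theory Num.Theory.
Import numFieldTopology.Exports numFieldNormedType.Exports.

Local Open Scope classical_set_scope.
Local Open Scope ring_scope.

(* A function on [0, +oo[ is represented by a total function on R; its values
   at negative arguments are never used. *)
Record dimension_function (R : realType) (h : R -> R) : Prop := {
  dimfun_ge0 : forall x, 0 <= x -> 0 <= h x ;
  dimfun_nondecreasing : forall x y, 0 <= x -> x <= y -> h x <= h y ;
  dimfun_right_continuous : forall x, 0 <= x -> h y @[y --> x^'+] --> h x ;
  dimfun0 : h 0 = 0 }.

(* The norm MathComp-Analysis puts on 'rV[R]_n is the sup norm, hence this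
   explicit Euclidean norm. *)
Definition euclidean_norm (R : realType) (n : nat) (x : 'rV[R]_n) : R :=
  Num.sqrt (\sum_(i < n) x 0 i ^+ 2).

(* Extended-real-valued, so that unbounded sets have diameter +oo; 0 is thrown
   in so that the empty set has diameter 0 (and not -oo). *)
Definition diam (R : realType) (n : nat) (A : set 'rV[R]_n) : \bar R :=
  ereal_sup (0%E |` [set (euclidean_norm (x - y))%:E | x in A & y in A]).

(* Finite covers are included: pad them with empty sets, for which
   h (diam set0) = h 0 = 0. *)
Definition hausdorff_content (R : realType) (n : nat) (h : R -> R) (delta : R)
    (E : set 'rV[R]_n) : \bar R :=
  ereal_inf [set (\sum_(0 <= i <oo) (h (fine (diam (F i))))%:E)%E |
    F in [set F : nat -> set 'rV[R]_n |
      E `<=` \bigcup_i F i /\ forall i, (diam (F i) < delta%:E)%E]].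

Definition hausdorff_measure (R : realType) (n : nat) (h : R -> R)
    (E : set 'rV[R]_n) : \bar R :=
  ereal_sup [set hausdorff_content h delta E | delta in [set d : R | 0 < d]].

(* Only s > 0 is used, since 0 `^ 0 = 1 and so x `^ 0 is not a dimension
   function; this does not change the infimum. *)
Definition hausdorff_dim (R : realType) (n : nat) (E : set 'rV[R]_n) : \bar R :=
  ereal_inf [set s%:E | s in
    [set s : R | 0 < s /\ hausdorff_measure (fun x => x `^ s) E = 0%E]].

Definition segment (R : realType) (n : nat) (a e : 'rV[R]_n) (L : R) :
    set 'rV[R]_n :=
  [set a + t *: e | t in `[0, L]%classic].

Definition furstenberg_set (R : realType) (h : R -> R) (E : set 'rV[R]_2) :
    Prop :=
  forall e : 'rV[R]_2, euclidean_norm e = 1 ->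
    exists (a : 'rV[R]_2) (L : R),
      0 < L /\ (0 < hausdorff_measure h (segment a e L `&` E))%E.

Definition extends_log_gauge (R : realType) (h : R -> R) : Prop :=
  \forall x \near (0 : R)^'+, h x = 1 / ln (1 / x).

Lemma ex_log_dimension_function (R : realType) :
  exists h : R -> R, dimension_function h /\ extends_log_gauge h.
Proof.
pose g (x : R) : R := 1 / Num.max 1 (ln (1 / x)).
pose h (x : R) : R := if x <= 0 then 0 else g x.
have m1 x : 1 <= Num.max 1 (ln (1 / x)) :> R by rewrite le_max lexx.
have m0 x : 0 < Num.max 1 (ln (1 / x)) :> R by exact: lt_le_trans (m1 x).
have g0 x : 0 <= g x by rewrite /g mul1r invr_ge0 ltW.
exists h; split; last first.
  near=> x.
  have x0 : 0 < x by near: x; exact: nbhs_right_gt.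
  have xe : x <= expR (-1) by near: x; apply: nbhs_right_le; exact: expR_gt0.
  rewrite /h (leNgt x 0) x0 /= /g max_r// div1r lnV ?posrE//.
  by rewrite lerNr -[leRHS](expRK (-1)) ler_ln ?posrE ?expR_gt0.
split => /=.
- by move=> x _; rewrite /h; case: ifP.
- move=> x y x0 xy; rewrite /h; case: (leP x 0) => [_|xp].
    by case: ifP.
  have yp := lt_le_trans xp xy.
  rewrite (leNgt y 0) yp /= /g !div1r lef_pV2 ?posrE//; last 2 first.
  + by have := m0 x; rewrite div1r.
  + by have := m0 y; rewrite div1r.
  rewrite ge_max le_max lexx /= le_max; apply/orP; right.
  by rewrite ler_ln ?posrE ?invr_gt0// lef_pV2 ?posrE.
- move=> x; rewrite le_eqVlt => /predU1P[<-|x0].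
    rewrite {2}/h lexx; apply/cvgrPdist_le => /= e e0; near=> y.
    have y0 : 0 < y by near: y; exact: nbhs_right_gt.
    have ye : y <= expR (- e^-1).
      by near: y; apply: nbhs_right_le; exact: expR_gt0.
    rewrite /h (leNgt y 0) y0 /= sub0r normrN ger0_norm// /g div1r.
    rewrite -[leRHS]invrK lef_pV2 ?posrE ?invr_gt0//.
    rewrite le_max; apply/orP; right.
    rewrite div1r lnV ?posrE// lerNr -[leRHS](expRK (- e^-1)).
    by rewrite ler_ln ?posrE ?expR_gt0.
  have cg : g y @[y --> x] --> g x.
    rewrite /g; apply: cvgM; first exact: cvg_cst.
    apply: cvgV; first by rewrite gt_eqF.
    have cl : ln (1 / y) @[y --> x] --> ln (1 / x).
      apply: (@cvg_comp _ _ _ (fun y : R => 1 / y) (@ln R) _ (nbhs (1 / x))).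
        apply: cvgM; first exact: cvg_cst.
        by apply: cvgV; [rewrite gt_eqF | exact: cvg_id].
      by apply: continuous_ln; rewrite div1r invr_gt0.
    under eq_fun do rewrite maxr_absE; rewrite maxr_absE.
    apply: cvgMr_tmp; apply: cvgD.
      by apply: cvgD; [exact: cvg_cst | exact: cl].
    by apply: cvg_norm; apply: cvgB; [exact: cvg_cst | exact: cl].
  have -> : h x = g x by rewrite /h (leNgt x 0) x0.
  apply: cvg_at_right_filter.
  apply: cvg_trans cg; apply: near_eq_cvg; near=> y.
  rewrite /h (leNgt y 0); suff -> : 0 < y by [].
  by near: y; exact: lt_nbhsr.
- by rewrite /h lexx.
Unshelve. all: by end_near. Qed.

(* Main.v *)
Require Import Defs.
From mathcomp Require Import all_boot all_order all_algebra.
From mathcomp Require Import all_classical all_reals all_analysis.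
From mathcomp Require Import ring lra zify.

(** The set is a countable intersection of finite unions of tiny boxes, one
    union for each stage [k], and is a variant of an example of Wolff.

    At stage [k] there are a large integer [n = scale k.+1] and a much smaller
    one [q = denom k], with [n = q ^ k.+1].  Take the lines [y = b + s x] whose
    coefficients lie on the lattice [b = j / n], [s = i / n + K j / n ^ 2] for
    integers [i], [j].  There are about [n ^ 2] of them, and for a suitable [K]
    every slope in [-1, 1] is realised up to an error [K / n ^ 2], with [b] in
    any prescribed interval of length about [1 / K].  A line of the lattice
    meets the vertical line [x = p / (q - (K / n) p)] at the height
    [(q j + p i) / (n (q - (K / n) p))].  On each of the [q + 1] fibres
    [0 <= p <= q] the heights are thus multiples of a fixed number, and there
    are only [O(q n)] of them: the [n ^ 2] lines meet the fibres in
    [O(q ^ 2 n)] points altogether.  Boxes of size about [K / n ^ 2] around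
    these points make up stage [k].  As [q] and [K] are [n] to a power that
    tends to [0], there are [n ^ (1 + o(1))] boxes of diameter
    [n ^ (- 2 + o(1))], which gives dimension at most [1 / 2]
    ([thin_set_content], [thin_set_dim]).

    Taking [K] of the order of the square of the previous [n] makes the stages
    compatible: a real line of given slope can be approximated at every stage
    at once ([exists_lattice_line]), and points whose abscissa is close to a
    fibre at every stage then lie on it in the set ([near_node]).  These
    abscissas contain the image of a map [cantor] of [0, 1), built by choosing
    at each stage one of [4 k + 12] consecutive fibres, in a cell that is
    [n ^ (- 2)] wide for the [n] of the preceding stage.

    It remains to see that the Cantor set has positive measure for the gauge
    [h (x) = 1 / log (1 / x)].  Two points separated at stage [k] have
    parameters at distance at most [1 / cells k] and images at distance at
    least [1 / (2 q)], where [log2 q = 8 * cells k] by the choice of [q]; so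
    [h] of the distance of the images is at least a constant times the
    distance of the parameters ([cantor_separated], [log_gauge_dyadic]).  Such
    an expansion property bounds the measure of the image from below, because
    the Lebesgue measure of [0, 1) is countably subadditive
    ([mass_distribution]). *)

Import Order.TTheory GRing.Theory Num.Theory.
Import numFieldTopology.Exports numFieldNormedType.Exports.

Local Open Scope classical_set_scope.
Local Open Scope ring_scope.

(** * Hausdorff contents and measures *)

Section HausdorffTools.
Context {R : realType} {n : nat}.
Implicit Types (A F : set 'rV[R]_n) (x y : 'rV[R]_n).

Lemma diam_ge0 A : (0 <= diam A)%E.
Proof. by apply: ereal_sup_ubound; left. Qed.

Lemma diam_set0 : diam (set0 : set 'rV[R]_n) = 0%E.
Proof.
apply/eqP; rewrite eq_le diam_ge0 andbT; apply: ge_ereal_sup => z [->//|].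
by move=> [x x0].
Qed.

Lemma dist_le_diam A x y :
  A x -> A y -> ((euclidean_norm (x - y))%:E <= diam A)%E.
Proof.
by move=> Ax Ay; apply: ereal_sup_ubound; right; exists x => //; exists y.
Qed.

Lemma diam_le A (d : R) : 0 <= d ->
  (forall x y, A x -> A y -> euclidean_norm (x - y) <= d) -> (diam A <= d%:E)%E.
Proof.
move=> d0 Ad; apply: ge_ereal_sup => _ [->|[x Ax [y Ay <-]]]; rewrite lee_fin//.
exact: Ad.
Qed.

Lemma euclidean_norm_ge0 x : 0 <= euclidean_norm x.
Proof. exact: sqrtr_ge0. Qed.

Lemma hausdorff_content_ge0 (h : R -> R) (delta : R) A :
  (forall t, 0 <= t -> 0 <= h t) ->
  (0 <= hausdorff_content h delta A)%E.
Proof.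
move=> h0; apply: le_ereal_inf_tmp => _ [F _ <-].
by apply: nneseries_ge0 => i _ _; rewrite lee_fin h0 ?fine_ge0 ?diam_ge0.
Qed.

(** A finite family becomes a sequence of sets by padding with empty sets, and
    these cost nothing since [h 0 = 0]. *)
Lemma hausdorff_content_finite_cover (h : R -> R) (I : finType)
    (B : I -> set 'rV[R]_n) (d delta : R) A :
    (forall t, 0 <= t -> 0 <= h t) ->
    (forall s t, 0 <= s -> s <= t -> h s <= h t) -> h 0 = 0 ->
    0 <= d -> d < delta ->
    (forall i, (diam (B i) <= d%:E)%E) -> A `<=` \bigcup_i B i ->
  (hausdorff_content h delta A <= (#|I|%:R * h d)%:E)%E.
Proof.
move=> hge0 hle h0 d0 dd Bd AB.
pose F k := if insub k is Some j then B (@enum_val I predT j) else set0.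
have Fd k : (diam (F k) <= d%:E)%E.
  by rewrite /F; case: insub => [j|]; rewrite ?diam_set0 ?lee_fin.
apply: (@le_trans _ _ (\sum_(0 <= i <oo) (h (fine (diam (F i))))%:E)%E).
  apply: ereal_inf_lbound; exists F => //; split.
    move=> x /AB[i _ Bix]; exists (enum_rank i) => //.
    rewrite /F; case: insubP => [j _ /ord_inj->|]; first by rewrite enum_rankK.
    by rewrite ltn_ord.
  by move=> k; rewrite (le_lt_trans (Fd k))// lte_fin.
have hF k : (0 <= (h (fine (diam (F k))))%:E)%E.
  by rewrite lee_fin hge0 ?fine_ge0 ?diam_ge0.
rewrite (nneseries_split _ #|I|)//.
rewrite [X in (_ + X)%E]eseries0 ?adde0; last first.
  move=> i; rewrite add0n => iI _; rewrite /F insubF; last by rewrite ltnNge iI.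
  by rewrite diam_set0 /= h0.
apply: (@le_trans _ _ (\sum_(0 <= k < #|I|) (h d)%:E)%E).
  apply: lee_sum => i _; rewrite lee_fin hle ?fine_ge0 ?diam_ge0//.
  rewrite -lee_fin fineK ?Fd// ge0_fin_numE ?diam_ge0//.
  by rewrite (le_lt_trans (Fd i))// ltry.
by rewrite sumEFin lee_fin sumr_const_nat subn0 mulr_natl.
Qed.

(** The preimage under [P] of a set of diameter [d] has diameter at most
    [h d / c], so lies in an interval of twice that length.  A cover of [A]
    with small sum would give a cover of [0, 1) by intervals of total length
    less than [1].  Sets of diameter [0] cause no trouble: their preimages
    have length [h 0 / c]. *)
Lemma mass_distribution (h : R -> R) (P : R -> 'rV[R]_n) (c : R) A :
    (forall t, 0 <= t -> 0 <= h t) ->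
    (forall s t, 0 <= s -> s <= t -> h s <= h t) ->
    0 < c -> (forall u, 0 <= u < 1 -> A (P u)) ->
    (forall u v, 0 <= u < 1 -> 0 <= v < 1 ->
      c * `|u - v| <= h (euclidean_norm (P u - P v))) ->
  (0 < hausdorff_measure h A)%E.
Proof.
move=> hge0 hle c0 PA Ph.
suff: ((c / 2)%:E <= hausdorff_content h 1 A)%E.
  move=> H; apply: (@lt_le_trans _ _ (c / 2)%:E).
     by rewrite lte_fin divr_gt0.
  by apply: (le_trans H); apply: ereal_sup_ubound; exists 1 => //=.
apply: le_ereal_inf_tmp => _ [F [AF Fd] <-].
have Ffin i : diam (F i) \is a fin_num.
  by rewrite ge0_fin_numE ?diam_ge0// (lt_trans (Fd i))// ltry.
pose l i := h (fine (diam (F i))) / c.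
have l0 i : 0 <= l i by rewrite divr_ge0 ?hge0 ?fine_ge0 ?diam_ge0 ?ltW.
pose S i := [set u : R | 0 <= u < 1 /\ F i (P u)].
have Sl i u v : S i u -> S i v -> `|u - v| <= l i.
  move=> [u1 Fu] [v1 Fv]; rewrite ler_pdivlMr// mulrC (le_trans (Ph _ _ u1 v1))//.
  apply: hle; first exact: euclidean_norm_ge0.
  by rewrite -lee_fin fineK//; exact: dist_le_diam.
(* A closed interval instead of [S i], which need not be measurable. *)
pose J i : set R := if pselect (S i !=set0) is left w then
  `[projT1 (cid w) - l i, projT1 (cid w) + l i]%classic else set0.
have SJ i : S i `<=` J i.
  move=> u Su; rewrite /J; case: pselect => [w|[]]; last by exists u.
  case: (cid w) => w' Sw' /=; rewrite in_itv /=.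
  by have := Sl _ _ _ Su Sw'; rewrite ler_distl.
have mJ i : measurable (J i) by rewrite /J; case: pselect.
have lJ i : (lebesgue_measure (J i) <=
    (2 / c)%:E * (h (fine (diam (F i))))%:E)%E.
  rewrite -EFinM (_ : 2 / c * _ = l i + l i); last first.
    by rewrite /l; field; rewrite gt_eqF.
  rewrite /J; case: pselect => [w|_]; last first.
    by rewrite measure0 lee_fin addr_ge0.
  rewrite lebesgue_measure_itv /= lte_fin; case: ifPn => _.
    by rewrite -EFinD lee_fin opprB addrCA addrAC subrr add0r lexx.
  by rewrite lee_fin addr_ge0.
have : (lebesgue_measure (`[0%R, 1%R[%classic : set R) <=
        \sum_(0 <= i <oo) lebesgue_measure (J i))%E.
  apply: measure_sigma_subadditive => //.
  move=> u; rewrite /= in_itv /= => u01.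
  have [i _ Fi] := AF _ (PA u u01).
  by exists i => //; apply: SJ.
rewrite lebesgue_measure_itv /= lte_fin ltr01 oppr0 adde0 => H.
have {}H : (1 <= \sum_(0 <= i <oo) (2 / c)%:E * (h (fine (diam (F i))))%:E)%E.
  by apply: (le_trans H); apply: lee_nneseries => i _ //; exact: lJ.
move: H.
rewrite nneseriesZl//; last first.
  by move=> i _; rewrite lee_fin hge0 ?fine_ge0 ?diam_ge0.
rewrite -[X in (X <= _)%E](_ : (2/c)%:E * (c/2)%:E = 1)%E; last first.
  by rewrite -EFinM; congr EFin; field; rewrite gt_eqF.
by rewrite lee_pmul2l// ?lte_fin ?divr_gt0.
Qed.

End HausdorffTools.

(** For large [m] this is the formula for the gauge, as
    [log (2 ^ m) = m log 2]; the finitely many remaining [m] are absorbed in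
    the constant by monotonicity. *)
Lemma log_gauge_dyadic (R : realType) (h : R -> R) : extends_log_gauge h ->
    (forall s t, 0 <= s -> s <= t -> h s <= h t) ->
  exists2 c : R, 0 < c & forall m, (0 < m)%N -> c / m%:R <= h (2 ^- m).
Proof.
move=> [e /= e0 he] hle.
have ln2 : 0 < ln 2 :> R by rewrite ln_gt0// ltr1n.
have he' x : 0 < x -> x < e -> h x = 1 / ln (1 / x).
  by move=> x0 xe; apply: he => //=; rewrite sub0r normrN gtr0_norm.
have pow0 m : 0 < 2 ^- m :> R by rewrite invr_gt0 exprn_gt0.
have hpow m : (0 < m)%N -> 2 ^- m < e -> h (2 ^- m) = (m%:R * ln 2)^-1.
  move=> m0 me; rewrite he'// !div1r invrK lnXn// mulr_natl //.
pose m0 := (Num.truncn e^-1).+1.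
have m0e : 2 ^- m0 < e.
  rewrite -[e]invrK ltf_pV2 ?posrE ?invr_gt0 ?exprn_gt0//.
  apply: (lt_trans (truncnS_gt _)); rewrite -natrX ltr_nat.
  exact: ltn_expl.
have m0R : 0 < m0%:R * ln 2 :> R by rewrite mulr_gt0// ltr0n.
have pow_le i j : (i <= j)%N -> 2 ^- j <= 2 ^- i :> R.
  by move=> ij; rewrite lef_pV2 ?posrE ?exprn_gt0// ler_weXn2l// ler1n.
exists (m0%:R * ln 2)^-1; first by rewrite invr_gt0.
move=> m m1; have mR : 1 <= m%:R :> R by rewrite ler1n.
have [m0m|/ltnW mm0] := leqP m0 m.
  rewrite hpow//; last by apply: le_lt_trans m0e; exact: pow_le.
  rewrite -invfM lef_pV2 ?posrE ?mulr_gt0 ?ltr0n//.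
  by rewrite mulrAC ler_pM2r// ler_peMl// ler1n.
apply: le_trans (hle _ _ (ltW (pow0 m0)) (pow_le _ _ mm0)).
by rewrite hpow// ler_pdivrMr ?ltr0n// ler_peMr// invr_ge0 ltW.
Qed.

(** * Parameters of the construction *)

(** The growth rates must balance.  The gauge sees the stage [k] cells if
    [log2 (denom k)] is of the order of [cells k]; a cell of width
    [scale k ^ (- 2)] must contain [branching k] fibres, so [denom k] must
    exceed [branching k * scale k ^ 2]; and [scale k.+1] must be a power of
    [denom k] whose exponent tends to infinity.  Then [log2 (denom k)] grows by
    a factor of about [2 k] at each stage, and the number of cells has to grow
    faster, whence the factor [4 k + 12]. *)
Definition branching (k : nat) : nat := (4 * k + 12)%N.

Lemma branching_gt0 k : (0 < branching k)%N.
Proof. by rewrite /branching addnC. Qed.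

Fixpoint cells (k : nat) : nat :=
  if k is k'.+1 then (branching k' * cells k')%N else 1%N.

Definition denom (k : nat) : nat := (2 ^ (8 * cells k))%N.

Definition scale (k : nat) : nat :=
  if k is k'.+1 then (denom k' ^ k)%N else 1%N.

Lemma leq_cells k : (k < cells k)%N.
Proof. by elim: k => //= k IH; rewrite /branching; nia. Qed.

Lemma denom_gt k : (k < denom k)%N.
Proof.
apply: (leq_trans (leq_cells k)); rewrite /denom.
apply: leq_trans (ltnW (ltn_expl _ (isT : 1 < 2)%N)).
by rewrite leq_pmull.
Qed.

Lemma scale_gt0 k : (0 < scale k)%N.
Proof. by case: k => //= k; rewrite expn_gt0 expn_gt0. Qed.

Lemma leq_denom_scale k : (denom k <= scale k.+1)%N.
Proof.
rewrite /= -[leqLHS]expn1 leq_exp2l// /denom (ltn_exp2l 0)// muln_gt0.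
exact: leq_trans (leq_cells k).
Qed.

(** The room needed to nest one stage into the preceding one comes from this
    inequality; its constants are what the numbers of fibres and the lattice of
    lines require. *)
Lemma denom_dominates k : ((16 * k + 53) * scale k ^ 2 <= denom k)%N.
Proof.
case: k => [|k]; first by rewrite /scale /denom.
rewrite /scale /denom -!expnM [cells k.+1]/= /branching.
set N := cells k; have N0 : (0 < N)%N by apply: leq_trans (leq_cells k).
have -> : (8 * ((4 * k + 12) * N) = (16 * k + 80) * N + 8 * N * k.+1 * 2)%N by ring.
rewrite expnD mulnA leq_mul//.
apply: leq_trans (ltnW (ltn_expl _ (isT : 1 < 2)%N)).
nia.
Qed.

(** * Fibres and the Cantor set of abscissas *)

Section Fibres.
Context {R : realType}.
Implicit Types (c s t u v : R) (k m p : nat).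

Lemma nested_intervals (lo w : nat -> R) : (forall k, 0 <= w k) ->
    (forall k, lo k <= lo k.+1) -> (forall k, lo k.+1 + w k.+1 <= lo k + w k) ->
  forall k, lo k <= sup (range lo) <= lo k + w k.
Proof.
move=> w0 lo_le hi_le k.
have lo_mono : {homo lo : i j / (i <= j)%N >-> i <= j} by apply/nondecreasing_seqP.
have hi_mono i j : (i <= j)%N -> lo j + w j <= lo i + w i.
  elim: j => [|j IH]; first by rewrite leqn0 => /eqP->.
  rewrite leq_eqVlt => /predU1P[->//|]; rewrite ltnS => /IH; exact: le_trans.
have ubk : ubound (range lo) (lo k + w k).
  move=> _ [j _ <-]; have [jk|/ltnW kj] := leqP j k.
    by rewrite (le_trans (lo_mono _ _ jk))// lerDl.
  by rewrite (le_trans _ (hi_mono _ _ kj))// lerDl.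
apply/andP; split.
  by apply: ub_le_sup; [exists (lo k + w k)|exists k].
by apply: ge_sup => //; exists (lo k); exists k.
Qed.

(** The coefficient [K / n] of the lattice of lines of stage [k], for
    [K = 4 (scale k) ^ 2] and [n = scale k.+1]. *)
Definition skew k : R := 4 * (scale k)%:R ^+ 2 / (scale k.+1)%:R.

Definition width k : R := (scale k)%:R ^- 2.

(** The abscissa that is the image of [t / q], for [q = denom k], under the
    projective map [r |-> r / (1 - skew k * r)], which makes the lattice of
    lines of stage [k] cross it at few heights when [t] is an integer. *)
Definition fibre k t : R := t / ((denom k)%:R - skew k * t).

Lemma scaleR_gt0 k : 0 < (scale k)%:R :> R.
Proof. by rewrite ltr0n scale_gt0. Qed.

Lemma denomR_gt0 k : 0 < (denom k)%:R :> R.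
Proof. by rewrite ltr0n (leq_ltn_trans _ (denom_gt k)). Qed.

Lemma denomR_ge k : (16 * k%:R + 53) * (scale k)%:R ^+ 2 <= (denom k)%:R :> R.
Proof.
rewrite -natrX -[16]/(16%:R) -[53]/(53%:R) -natrM -natrD -natrM ler_nat.
exact: denom_dominates.
Qed.

Lemma denomR_le k : (denom k)%:R <= (scale k.+1)%:R :> R.
Proof. by rewrite ler_nat leq_denom_scale. Qed.

Lemma skew_ge0 k : 0 <= skew k.
Proof. by rewrite /skew divr_ge0 ?mulr_ge0 ?exprn_ge0. Qed.

Lemma skew_le k : skew k <= 1 / 2.
Proof.
rewrite /skew ler_pdivrMr ?scaleR_gt0//.
have := denomR_ge k; have := denomR_le k.
have : 0 <= k%:R * (scale k)%:R ^+ 2 :> R by rewrite mulr_ge0 ?exprn_ge0.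
have : 0 <= (scale k)%:R ^+ 2 :> R by rewrite exprn_ge0.
nra.
Qed.

Lemma width_gt0 k : 0 < width k.
Proof. by rewrite invr_gt0 exprn_gt0 ?scaleR_gt0. Qed.

Lemma width_succ_le k : width k.+1 <= (denom k)%:R^-1.
Proof.
rewrite /width lef_pV2 ?posrE ?exprn_gt0 ?scaleR_gt0 ?denomR_gt0//.
have H : 1 <= (denom k)%:R :> R by rewrite ler1n (leq_ltn_trans _ (denom_gt k)).
by have := denomR_le k; nra.
Qed.

Lemma width_succ_half k : width k.+1 <= (2 * (denom k)%:R)^-1.
Proof.
rewrite /width lef_pV2 ?posrE ?exprn_gt0 ?mulr_gt0 ?scaleR_gt0 ?denomR_gt0//.
have H : 2 <= (denom k)%:R :> R.
  rewrite -[2]/(2%:R) ler_nat /denom -{1}[2%N]expn1 leq_exp2l// muln_gt0 /=.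
  by apply: leq_trans (leq_cells k).
by have := denomR_le k; nra.
Qed.

Lemma height_bounds {k t} : 0 <= t -> t <= (denom k)%:R ->
  (denom k)%:R / 2 <= (denom k)%:R - skew k * t <= (denom k)%:R.
Proof.
move=> t0 tq; have := skew_ge0 k; have := skew_le k.
by move=> *; apply/andP; split; nra.
Qed.

(** The projective map has derivative between [1] and [4] on [0, 1], because
    [skew k <= 1 / 2]. *)
Lemma fibre_gap {k s t} : 0 <= s -> s <= t -> t <= (denom k)%:R ->
  (t - s) / (denom k)%:R <= fibre k t - fibre k s <= 4 * (t - s) / (denom k)%:R.
Proof.
move=> s0 st tq; have q0 := denomR_gt0 k.
have /andP[a1 a2] := height_bounds (le_trans s0 st) tq.
have /andP[b1 b2] := height_bounds s0 (le_trans st tq).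
rewrite /fibre; set q := (denom k)%:R in q0 tq a1 a2 b1 b2 *.
set a := q - skew k * t in a1 a2 *; set b := q - skew k * s in b1 b2 *.
have a0 : 0 < a by nra.
have b0 : 0 < b by nra.
have -> : t / a - s / b = (t - s) * (q / (a * b)).
  have tbsa : t * b - s * a = q * (t - s) by rewrite /a /b; ring.
  rewrite mulrA [(t - s) * q]mulrC -tbsa; field.
  by rewrite !gt_eqF.
have ab0 : 0 < a * b by rewrite mulr_gt0.
have lower : q^-1 <= q / (a * b).
  by rewrite ler_pdivlMr// mulrC ler_pdivrMr//; nra.
have upper : q / (a * b) <= 4 / q.
  by rewrite ler_pdivrMr// mulrAC ler_pdivlMr//; nra.
by rewrite [4 * _]mulrC -mulrA !ler_wpM2l ?subr_ge0.
Qed.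

(** The real number under [truncn] is the preimage of [c] under [fibre k], so
    this is the index of the first fibre beyond [c]. *)
Definition next_index k c : nat :=
  (Num.truncn ((denom k)%:R * c / (1 + skew k * c))).+1.

(** Fibres are at most [4 / denom k] apart, so that [branching k] of them, with
    their cells of stage [k.+1], fit in a cell of stage [k]. *)
Lemma next_fibre {k c} {d : nat} :
    (d < branching k)%N -> 0 <= c -> c + width k <= 1 ->
  let p := (next_index k c + d)%N in
  [/\ (p <= denom k)%N, c <= fibre k p%:R &
      fibre k p%:R + width k.+1 <= c + width k].
Proof.
move=> dM c0 cw p.
have q0 := denomR_gt0 k; have s0 := skew_ge0 k; have w0 := width_gt0 k.
set q := (denom k)%:R : R in q0.
pose t := q * c / (1 + skew k * c).
have sc0 : 0 < 1 + skew k * c by nra.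
have t0 : 0 <= t by rewrite divr_ge0 ?(ltW sc0) ?mulr_ge0 ?(ltW q0).
have tq : t <= q * c.
  rewrite ler_pdivrMr// mulrDr mulr1 lerDl.
  by rewrite !mulr_ge0// (ltW q0).
have tc : fibre k t = c.
  rewrite /fibre -/q /t; field; rewrite !gt_eqF//=.
  by rewrite (_ : _ - _ = q)//; ring.
have room : (16 * k%:R + 53) / q <= width k.
  rewrite ler_pdivrMr// [leRHS]mulrC /width ler_pdivlMr ?exprn_gt0 ?scaleR_gt0//.
  exact: denomR_ge.
have [tp pt] : t <= p%:R /\ p%:R <= t + (4 * k%:R + 12).
  have := truncn_itv t0 => /andP[t1 t2].
  rewrite /p /next_index -/q -/t natrD -natr1; split.
    by rewrite -natr1 in t2; have : 0 <= d%:R :> R by []; lra.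
  have : d%:R + 1 <= 4 * k%:R + 12 :> R.
    by rewrite natr1 -[4]/(4%:R) -[12]/(12%:R) -natrM -natrD ler_nat.
  lra.
have pq : p%:R <= q.
  have : 16 * k%:R + 53 <= width k * q by rewrite -ler_pdivrMr.
  have : 0 <= k%:R :> R by [].
  nra.
have /andP[g1 g2] := fibre_gap t0 tp pq.
split; first by rewrite -(ler_nat R).
  rewrite tc -/q in g1.
  have : 0 <= (p%:R - t) / q by rewrite divr_ge0 ?(ltW q0) ?subr_ge0.
  lra.
have := width_succ_le k; rewrite -/q.
rewrite tc -/q in g2.
have : 4 * (p%:R - t) / q + q^-1 <= (16 * k%:R + 53) / q.
  have -> : 4 * (p%:R - t) / q + q^-1 = (4 * (p%:R - t) + 1) / q by ring.
  by rewrite ler_pM2r ?invr_gt0//; lra.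
lra.
Qed.

(** The left end of the cell of index [m] among the [cells k] cells of stage
    [k], which has width [width k].  Cell [m] of stage [k.+1] is inside cell
    [m %/ branching k] of stage [k]. *)
Fixpoint corner k m : R :=
  if k is k'.+1 then
    fibre k' (next_index k' (corner k' (m %/ branching k'))
              + m %% branching k')%:R
  else 0.

Lemma corner_bounds k m : 0 <= corner k m /\ corner k m + width k <= 1.
Proof.
elim: k m => [|k IH] m; first by rewrite /= /width /= expr1n invr1 add0r.
have [c0 c1] := IH (m %/ branching k)%N.
have [_ cl cu] := next_fibre (ltn_pmod m (branching_gt0 k)) c0 c1.
by split; [exact: le_trans cl | exact: le_trans cu c1].
Qed.

Lemma corner_nested k m (c := corner k (m %/ branching k)) :
  c <= corner k.+1 m /\ corner k.+1 m + width k.+1 <= c + width k.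
Proof.
have [c0 c1] := corner_bounds k (m %/ branching k)%N.
by have [_ ? ?] := next_fibre (ltn_pmod m (branching_gt0 k)) c0 c1.
Qed.

(** The first [k] digits of [u] in the mixed radix system of bases
    [branching 0, ..., branching k.-1], read as one integer. *)
Definition address k u : nat := Num.truncn (u * (cells k)%:R).

Lemma cellsR_gt0 k : 0 < (cells k)%:R :> R.
Proof. by rewrite ltr0n (leq_ltn_trans _ (leq_cells k)). Qed.

Lemma address_itv k {u} : 0 <= u ->
  (address k u)%:R <= u * (cells k)%:R < (address k u)%:R + 1.
Proof.
by move=> u0; rewrite natr1; apply: truncn_itv; rewrite mulr_ge0.
Qed.

Lemma address_succ k {u} : 0 <= u ->
  (address k.+1 u %/ branching k)%N = address k u.
Proof.
move=> u0; apply/esym/eqP; rewrite [address k u]/address.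
have M0 := branching_gt0 k.
rewrite truncn_eq ?mulr_ge0//.
have := address_itv k.+1 u0; rewrite [cells k.+1]/= natrM.
set a := address _ _; set b := (a %/ _)%N => /andP[alo ahi].
have M0' : 0 < (branching k)%:R :> R by rewrite ltr0n.
have blo : b%:R * (branching k)%:R <= a%:R :> R.
  by rewrite -natrM ler_nat leq_divM.
have bhi : a%:R + 1 <= b.+1%:R * (branching k)%:R :> R.
  by rewrite natr1 -natrM ler_nat ltn_ceil.
apply/andP; split.
  by rewrite -(ler_pM2r M0'); lra.
by rewrite -(ltr_pM2r M0'); lra.
Qed.

(** The point common to the cells with the addresses of [u]. *)
Definition cantor u : R := sup (range (fun k => corner k (address k u))).

Lemma cantor_cell k {u} : 0 <= u ->
  corner k (address k u) <= cantor u <= corner k (address k u) + width k.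
Proof.
move=> u0; apply: (@nested_intervals (fun k => corner k (address k u)) width).
- by move=> j; exact/ltW/width_gt0.
- move=> j; have [+ _] := corner_nested j (address j.+1 u).
  by rewrite address_succ.
- move=> j; have [_] := corner_nested j (address j.+1 u).
  by rewrite address_succ.
Qed.

Lemma cantor_itv {u} : 0 <= u -> 0 <= cantor u <= 1.
Proof. by move=> /(cantor_cell 0); rewrite /= /width expr1n invr1 add0r. Qed.

Lemma cantor_fibre k {u} : 0 <= u -> exists2 p, (p <= denom k)%N &
  fibre k p%:R <= cantor u <= fibre k p%:R + width k.+1.
Proof.
move=> u0; have := cantor_cell k.+1 u0 => /=.
have [c0 c1] := corner_bounds k (address k.+1 u %/ branching k)%N.
have [pq _ _] := next_fibre (ltn_pmod (address k.+1 u) (branching_gt0 k)) c0 c1.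
by move=> ?; eexists; eauto.
Qed.

Lemma fibre_separated k m m' :
    (m %/ branching k)%N = (m' %/ branching k)%N -> m <> m' ->
  (denom k)%:R^-1 <= `|corner k.+1 m - corner k.+1 m'|.
Proof.
wlog mm' : m m' / (m < m')%N.
  move=> H e mm'; have [|] := ltnP m m'; first by move=> ?; exact: H.
  rewrite leq_eqVlt => /predU1P[/esym//|m'm].
  by rewrite distrC; apply: H => //; exact/nesym.
move=> e _ /=.
have [c0 c1] := corner_bounds k (m %/ branching k)%N.
have [p1 _ _] := next_fibre (ltn_pmod m (branching_gt0 k)) c0 c1.
have [p2 _ _] := next_fibre (ltn_pmod m' (branching_gt0 k)) c0 c1.
rewrite -e; set p := (_ + _)%N in p1 *; set p' := (_ + _)%N in p2 *.
have pp' : (p < p')%N.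
  rewrite /p /p' ltn_add2l -(ltn_add2l (m %/ branching k * branching k)).
  by rewrite -divn_eq e -divn_eq.
have /andP[gap _] : (p'%:R - p%:R) / (denom k)%:R <= _ <= _ :=
  fibre_gap (ler0n R p) (etrans (ler_nat R p p') (ltnW pp'))
            (etrans (ler_nat R _ _) p2).
rewrite distrC (le_trans _ (ler_norm _))// (le_trans _ gap)//.
rewrite ler_peMl ?invr_ge0// lerBrDr nat1r ler_nat.
exact: pp'.
Qed.

(** At the first stage where the addresses of [u] and [v] differ, the
    preceding addresses agree, which bounds the distance of [u] and [v], and
    the two cells start at distinct fibres, which bounds the distance of the
    images. *)
Lemma cantor_separated {u v} : 0 <= u < 1 -> 0 <= v < 1 -> u != v ->
  exists k, `|u - v| <= (cells k)%:R^-1 /\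
            2 ^- (8 * cells k).+1 <= `|cantor u - cantor v|.
Proof.
move=> /andP[u0 u1] /andP[v0 v1] uv.
have close j : address j u = address j v -> `|u - v| < (cells j)%:R^-1.
  move=> e; have := address_itv j u0; have := address_itv j v0.
  rewrite e => /andP[? ?] /andP[? ?].
  rewrite -[ltRHS]mul1r ltr_pdivlMr ?cellsR_gt0//.
  rewrite -[(cells j)%:R]ger0_norm// -normrM mulrBl ltr_norml.
  by apply/andP; split; lra.
(* The addresses separate [u] from [v] because [cells k] is unbounded. *)
have ex : exists k, address k u != address k v.
  exists (Num.truncn `|u - v|^-1); apply/eqP => /close.
  have uv0 : 0 < `|u - v| by rewrite normr_gt0 subr_eq0.
  rewrite -[`|u - v|]invrK ltf_pV2 ?posrE ?invr_gt0 ?cellsR_gt0// invrK.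
  rewrite ltNge ltW// (lt_le_trans (truncnS_gt _))// ler_nat.
  exact: leq_cells.
case: (ex_minnP ex) => -[|k] neq least.
  move: neq; rewrite /address !mulr1.
  have /eqP-> : Num.truncn u == 0%N by rewrite truncn_eq ?u0.
  have /eqP-> : Num.truncn v == 0%N by rewrite truncn_eq ?v0.
  by rewrite eqxx.
have same : address k u = address k v.
  by apply/eqP; apply: contraT => /least; rewrite ltnn.
exists k; split; first exact/ltW/close.
have := @fibre_separated k (address k.+1 u) (address k.+1 v).
rewrite !address_succ// => /(_ same (elimN eqP neq)).
have := cantor_cell k.+1 u0; have := cantor_cell k.+1 v0.
have := width_succ_half k; rewrite exprS -natrX -/(denom k) !invfM.
set cu := corner _ (address _ u); set cv := corner _ (address _ v).
set q := (denom k)%:R^-1.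
move=> wq /andP[? ?] /andP[? ?] gap.
have [cuv|cuv] := lerP cv cu.
  rewrite ger0_norm ?subr_ge0// in gap.
  by rewrite (le_trans _ (ler_norm _))//; lra.
rewrite ltr0_norm ?subr_lt0// in gap.
by rewrite distrC (le_trans _ (ler_norm _))//; lra.
Qed.

End Fibres.

(** * Lattices of lines *)

Section Lines.
Context {R : realType}.
Implicit Types (b s x : R) (k p j : nat) (i z : int).

(** The line of the stage [k] lattice that approximates a line of slope [s] has
    intercept [j / n] and slope [i / n + skew k * (j / n)].  Here [i] is
    chosen first, so that the value [n s - i] to be reached by [skew k * j] lies
    between [K b + 1] and [K b + 2], and [j] next, by rounding. *)
Definition next_shift k s b : int :=
  Num.floor ((scale k.+1)%:R * s - 4 * (scale k)%:R ^+ 2 * b - 1).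

Definition next_intercept k s b : nat :=
  Num.truncn (((scale k.+1)%:R * s - (next_shift k s b)%:~R) / skew k).

Lemma skew_gt0 k : 0 < skew k :> R.
Proof. by rewrite /skew divr_gt0 ?mulr_gt0 ?exprn_gt0 ?scaleR_gt0. Qed.

(** The values [skew k * j] have spacing [skew k], and they sweep an interval
    of length more than [2] while [j / n] runs over [b, b + width k], because
    [skew k * n * width k = 4].  Hence the slope can be matched modulo [1 / n]
    without leaving the current interval of intercepts. *)
Lemma next_line k s b (b' := (next_intercept k s b)%:R / (scale k.+1)%:R) :
    0 <= b ->
  [/\ b <= b', b' + width k.+1 <= b + width k &
      `|s - (next_shift k s b)%:~R / (scale k.+1)%:R - skew k * b'|
        <= skew k / (scale k.+1)%:R].
Proof.
move=> b0; rewrite {}/b' /next_intercept.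
set i := next_shift k s b; set n := (scale k.+1)%:R.
have n0 : 0 < n := scaleR_gt0 k.+1.
have K0 := @skew_gt0 k; have K1 := @skew_le R k.
set K := skew k in K0 K1 *.
have w0 := @width_gt0 R k.
have Kn : K * n * width k = 4.
  by rewrite /K /skew /width -/n; field; rewrite !gt_eqF ?scaleR_gt0.
have S0 := @scaleR_gt0 R k.
have [i1 i2] : K * n * b + 1 <= n * s - i%:~R /\ n * s - i%:~R <= K * n * b + 2.
  have -> : K * n * b = 4 * (scale k)%:R ^+ 2 * b.
    by rewrite /K /skew -/n; field; rewrite gt_eqF.
  have := floor_itv (n * s - 4 * (scale k)%:R ^+ 2 * b - 1).
  rewrite -/(next_shift k s b) -/i intrD => /andP[? ?].
  by split; lra.
set t := (n * s - i%:~R) in i1 i2 *.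
have Kb : 0 <= K * n * b by rewrite !mulr_ge0 ?(ltW K0) ?(ltW n0).
have tK : 0 <= t / K by apply: divr_ge0; lra.
have /andP[j1 j2] := truncn_itv tK.
set j := Num.truncn _ in j1 j2 *.
rewrite -natr1 in j2.
have {}j1 : K * j%:R <= t by rewrite mulrC -ler_pdivlMr.
have {}j2 : t < K * (j%:R + 1) by rewrite mulrC -ltr_pdivrMr.
split.
- rewrite ler_pdivlMr// -(ler_pM2l K0); nra.
- have wk : width k.+1 <= width k / 2 :> R.
    have qk := @denomR_ge R k; have q0 := @denomR_gt0 R k.
    apply: (le_trans (width_succ_le k)).
    rewrite ler_pdivlMr// mulrC ler_pdivrMr// /width mulrC ler_pdivlMr ?exprn_gt0//.
    have : 0 <= k%:R * (scale k)%:R ^+ 2 :> R by rewrite mulr_ge0 ?exprn_ge0.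
    have : 0 <= (scale k)%:R ^+ 2 :> R by rewrite exprn_ge0.
    lra.
  suff : j%:R / n <= b + width k / 2 by lra.
  rewrite ler_pdivrMr// -(ler_pM2l K0).
  have -> : K * ((b + width k / 2) * n) = K * n * b + K * n * width k / 2 by field.
  by rewrite Kn; lra.
- have -> : s - i%:~R / n - K * (j%:R / n) = (t - K * j%:R) / n.
    by rewrite /t; field; rewrite gt_eqF.
  rewrite normrM [X in _ * X]gtr0_norm ?invr_gt0// ler_pM2r ?invr_gt0//.
  by rewrite ger0_norm; lra.
Qed.

Fixpoint intercept s k : R :=
  if k is k'.+1 then (next_intercept k' s (intercept s k'))%:R / (scale k)%:R
  else 0.

Lemma intercept_ge0 s k : 0 <= intercept s k.
Proof. by case: k => //= k; rewrite divr_ge0. Qed.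

(** At every stage the line [y = b + s x] is close to a line of the lattice
    of this stage, of intercept [b']. *)
Definition lattice_approximable s b := forall k,
  exists j i (b' := j%:R / (scale k.+1)%:R),
    [/\ (j <= scale k.+1)%N, (`|i| <= 2 * scale k.+1)%N,
        b' <= b <= b' + width k.+1 &
        `|s - i%:~R / (scale k.+1)%:R - skew k * b'| <= skew k / (scale k.+1)%:R].

(** The intervals of intercepts produced by [next_line] are nested, and their
    common point is [b]. *)
Lemma exists_lattice_line s : `|s| <= 1 -> exists b, lattice_approximable s b.
Proof.
move=> s1.
have step k := next_line k s _ (intercept_ge0 s k).
have nest := @nested_intervals R (intercept s) width
  (fun k => ltW (width_gt0 k))
  (fun k => let: And3 lo _ _ := step k in lo)
  (fun k => let: And3 _ hi _ := step k in hi).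
exists (sup (range (intercept s))) => k; have [_ _ err] := step k.
exists (next_intercept k s (intercept s k)), (next_shift k s (intercept s k)).
have n0 := @scaleR_gt0 R k.+1; have bk := nest k.+1.
move: err bk; rewrite [intercept s k.+1]/=.
set j := next_intercept _ _ _; set i := next_shift _ _ _.
set n := (scale k.+1)%:R in n0 *; move=> err bk.
have j1 : j%:R / n <= 1.
  have /andP[+ _] := bk; have := nest 0%N.
  by rewrite /= /width expr1n invr1 add0r => /andP[_ ? ?]; lra.
have K0 := @skew_gt0 k; have K1 := @skew_le R k.
have n1 : 1 <= n by rewrite /n ler1n scale_gt0.
split=> //; first by rewrite -(ler_nat R) -[leRHS]mul1r -ler_pdivrMr// -/n.
rewrite -(ler_nat R) natrM -/n natr_absz intr_norm.
have b0 : 0 <= j%:R / n by rewrite divr_ge0// ltW.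
have err' : `|n * s - i%:~R - skew k * (n * (j%:R / n))| <= skew k.
  have -> : n * s - i%:~R - skew k * (n * (j%:R / n)) =
            (s - i%:~R / n - skew k * (j%:R / n)) * n.
    by field; rewrite gt_eqF.
  by rewrite normrM (gtr0_norm n0) -ler_pdivlMr.
move: s1 err'; rewrite !ler_norml => /andP[? ?] /andP[? ?].
have : n * (j%:R / n) <= n by rewrite ler_piMr// ltW.
have : 0 <= n * (j%:R / n) by rewrite mulr_ge0// ltW.
by move=> *; apply/andP; split; nra.
Qed.

(** About [K / n ^ 2], the precision with which the lattice of stage [k]
    approximates slopes. *)
Definition radius k : R := 2 * skew k / (scale k.+1)%:R.

(** The possible heights on a fibre: the lattice line with parameters [i], [j]
    crosses the fibre of index [p] at [node k p (denom k * j + i * p)]. *)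
Definition node k p z : R :=
  z%:~R / ((scale k.+1)%:R * ((denom k)%:R - skew k * p%:R)).

(** The lattice line passes exactly through a node on the fibre, and the true
    point differs from it by the errors on the intercept, the slope and the
    abscissa. *)
Lemma near_node {s b k p x} : `|s| <= 1 -> lattice_approximable s b ->
  (p <= denom k)%N -> x <= 1 ->
  fibre k p%:R <= x <= fibre k p%:R + width k.+1 ->
  exists2 z, (`|z| <= 3 * (denom k * scale k.+1))%N &
     `|x - fibre k p%:R| <= radius k /\ `|b + s * x - node k p z| <= radius k.
Proof.
move=> s1 lines pq x1 xp; have [j [i [jn iN bj err]]] := lines k.
exists ((denom k * j)%:Z + i * p%:Z); first by nia.
have n0 := @scaleR_gt0 R k.+1; have K0 := @skew_gt0 k.
have q0 := @denomR_gt0 R k.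
have pqR : p%:R <= (denom k)%:R :> R by rewrite ler_nat.
have /andP[h1 h2] := height_bounds (ler0n R p) pqR.
have -> : node k p ((denom k * j)%:Z + i * p%:Z) =
    j%:R / (scale k.+1)%:R +
    (i%:~R / (scale k.+1)%:R + skew k * (j%:R / (scale k.+1)%:R)) * fibre k p%:R.
  rewrite /node /fibre intrD intrM -!pmulrn natrM.
  have D0 : (denom k)%:R - skew k * p%:R != 0 :> R by rewrite gt_eqF//; lra.
  by field; rewrite D0 gt_eqF.
have f0 : 0 <= fibre k p%:R :> R by rewrite /fibre divr_ge0//; lra.
have wK : width k.+1 <= skew k / (scale k.+1)%:R / 4 :> R.
  rewrite /width /skew (_ : _ / 4 = (scale k)%:R ^+ 2 * (scale k.+1)%:R ^- 2).
    by rewrite ler_peMl ?invr_ge0 ?exprn_ge0// exprn_ege1// ler1n scale_gt0.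
  by field; rewrite gt_eqF.
have w0 := @width_gt0 R k.+1.
have rE : radius k = 2 * (skew k / (scale k.+1)%:R) by rewrite /radius mulrA.
move: bj xp err rE wK.
set B := j%:R / _; set f := fibre _ _ in f0 *; set w := width _ in w0 *.
set e := skew k / _.
set sl := i%:~R / _ => /andP[b1 b2] /andP[x2 x3] err -> wK.
split; first by rewrite ler_norml; lra.
rewrite (_ : _ - _ = (b - B) + s * (x - f) + (s - sl - skew k * B) * f);
  last by ring.
have : `|s * (x - f)| <= w.
  by rewrite normrM -[leRHS]mul1r ler_pM// ger0_norm; lra.
have : `|(s - sl - skew k * B) * f| <= e.
  by rewrite normrM -[leRHS]mulr1 ler_pM// ger0_norm; lra.
by rewrite !ler_norml => *; lra.
Qed.

End Lines.

(** * The thin Furstenberg set *)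

Section ThinSet.
Context {R : realType}.
Implicit Types (k p : nat) (z : int) (o : 'I_2) (v w e : 'rV[R]_2).

Lemma euclidean_norm2 o v :
  euclidean_norm v = Num.sqrt (v 0 o ^+ 2 + v 0 (o + 1) ^+ 2).
Proof.
rewrite /euclidean_norm; congr Num.sqrt.
rewrite big_ord_recl big_ord1; case: o => -[|[|//]] lo.
  by congr (v 0 _ ^+ 2 + v 0 _ ^+ 2); apply: val_inj.
by rewrite addrC; congr (v 0 _ ^+ 2 + v 0 _ ^+ 2); apply: val_inj.
Qed.

Lemma coord_le_norm o v : `|v 0 o| <= euclidean_norm v.
Proof.
by rewrite (euclidean_norm2 o) -sqrtr_sqr ler_sqrt ?lerDl ?addr_ge0 ?sqr_ge0.
Qed.

(** The index [o] says which coordinate is used as abscissa, and [o + 1],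
    computed modulo [2], is the other one.  Exchanging the coordinates gives
    the directions of slope larger than [1] in absolute value. *)
Definition box k o p z : set 'rV[R]_2 :=
  [set v | `|v 0 o - fibre k p%:R| <= radius k /\
           `|v 0 (o + 1) - node k p z| <= radius k].

Definition thin_set : set 'rV[R]_2 :=
  [set v | forall k, exists o p z,
    [/\ (p <= denom k)%N, (`|z| <= 3 * (denom k * scale k.+1))%N &
        box k o p z v]].

Lemma radius_ge0 k : 0 <= radius k :> R.
Proof. by rewrite divr_ge0// mulr_ge0// ltW// skew_gt0. Qed.

Lemma diam_box k o p z : (diam (box k o p z) <= (4 * radius k)%:E)%E.
Proof.
have r0 := radius_ge0 k.
apply: diam_le => [|v w [v0 v1] [w0 w1]]; first by rewrite mulr_ge0.
rewrite (euclidean_norm2 o) -[leRHS]ger0_norm ?mulr_ge0// -sqrtr_sqr.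
rewrite ler_sqrt ?sqr_ge0// !mxE.
have a2 (a b c : R) : `|a - c| <= radius k -> `|b - c| <= radius k ->
    (a - b) ^+ 2 <= (2 * radius k) ^+ 2.
  move=> ac bc; rewrite -real_normK ?num_real// lerXn2r ?nnegrE ?mulr_ge0//.
  by move: ac bc; rewrite !ler_norml => *; lra.
have := a2 _ _ _ v0 w0; have := a2 _ _ _ v1 w1.
by have := sqr_ge0 (radius k : R); lra.
Qed.

Lemma scale_succ k : (scale k.+1)%:R = (denom k)%:R ^+ k.+1 :> R.
Proof. by rewrite -natrX. Qed.

(** With [q = denom k] the diameter is at most [q / n ^ 2], since
    [32 * scale k ^ 2 <= q], and [n = q ^ k.+1]. *)
Lemma diam_bound k : 4 * radius k <= (denom k)%:R `^ (- (2 * k%:R + 1)) :> R.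
Proof.
have q0 := @denomR_gt0 R k; have qk := @denomR_ge R k.
rewrite (_ : 2 * k%:R + 1 = (2 * k + 1)%:R); last by rewrite natrD natrM.
rewrite powRN powR_mulrn//.
have -> : 4 * radius k = 32 * (scale k)%:R ^+ 2 * (scale k.+1)%:R ^- 2 :> R.
  by rewrite /radius /skew; field; rewrite gt_eqF ?scaleR_gt0.
have -> : (denom k)%:R ^- (2 * k + 1) = (denom k)%:R * (scale k.+1)%:R ^- 2 :> R.
  rewrite scale_succ -exprM (_ : k.+1 * 2 = (2 * k + 1).+1)%N; last by lia.
  by rewrite exprS; field; rewrite expf_neq0 gt_eqF.
rewrite ler_wpM2r ?invr_ge0 ?exprn_ge0//.
have : 0 <= k%:R * (scale k)%:R ^+ 2 :> R by rewrite mulr_ge0 ?exprn_ge0.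
have : 0 <= (scale k)%:R ^+ 2 :> R by rewrite exprn_ge0.
lra.
Qed.

(** There are at most [28 q ^ 2 n = 28 q ^ (k + 3)] boxes, of diameter at most
    [q ^ (- (2 k + 1))]. *)
Lemma thin_set_content (s delta : R) k : 0 < s -> (denom k)%:R^-1 < delta ->
    k%:R + 4 <= (2 * k%:R + 1) * s ->
  (hausdorff_content (fun x : R => (x `^ s)%R) delta thin_set <=
   (28 / (denom k)%:R)%:E)%E.
Proof.
move=> s0 qdelta ks.
pose N := (3 * (denom k * scale k.+1))%N.
pose I : finType := ('I_2 * 'I_(denom k).+1 * 'I_(2 * N).+1)%type.
pose B (i : I) := box k i.1.1 i.1.2 (i.2%:Z - N%:Z).
have q1 : 1 <= (denom k)%:R :> R.
  by rewrite ler1n (leq_ltn_trans _ (denom_gt k)).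
have r0 := @radius_ge0 k.
apply: le_trans.
  apply: (@hausdorff_content_finite_cover R 2 (fun x => x `^ s) I B
    (4 * radius k)).
- by move=> t _; exact: powR_ge0.
- by move=> t u t0 tu; rewrite ge0_ler_powR ?nnegrE ?(ltW s0) ?(le_trans t0 tu).
- by rewrite powR0// gt_eqF.
- by rewrite mulr_ge0.
- apply: le_lt_trans qdelta; apply: (le_trans (diam_bound k)).
  have := ler0n R k => k0.
  by rewrite -powR_inv1 ?ler0n// ler_powR// lerN2; lra.
- by move=> i; exact: diam_box.
- move=> v /(_ k) [ o [p [z [pq zN bv]]]].
  have zt : (absz (z + N%:Z)%R < (2 * N).+1)%N by rewrite -/N in zN; lia.
  exists (o, Ordinal (pq : (p < (denom k).+1)%N), Ordinal zt) => //.
  rewrite /B /= (_ : _ - _ = z)//; rewrite -/N in zN; lia.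
rewrite lee_fin !card_prod !card_ord.
have cardI : (2 * (denom k).+1 * (2 * N).+1)%:R <=
              28 * ((denom k)%:R `^ (k%:R + 3)) :> R.
  rewrite (_ : k%:R + 3 = (k.+1 + 2)%:R); last by rewrite natrD -natr1; ring.
  rewrite powR_mulrn ?ler0n// exprD -scale_succ -natrX -natrM.
  rewrite -[28]/(28%:R) -natrM.
  rewrite ler_nat /N.
  have := denom_gt k; have := scale_gt0 k.+1; clear.
  move: (denom k) (scale k.+1) => q n n0 kq.
  have qn : (0 < q * n)%N by rewrite muln_gt0 n0 (leq_ltn_trans _ kq).
  apply: (@leq_trans ((4 * q) * (7 * (q * n)))); first by apply: leq_mul; lia.
  by rewrite (_ : 28 * _ = (4 * q) * (7 * (q * n)))%N//; ring.
have dI : (4 * radius k) `^ s <= (denom k)%:R `^ (- (2 * k%:R + 1) * s) :> R.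
  rewrite powRrM ge0_ler_powR ?nnegrE ?powR_ge0 ?mulr_ge0 ?(ltW s0)//.
  exact: diam_bound.
apply: (le_trans (ler_pM _ _ cardI dI)) => //; first exact: powR_ge0.
rewrite -mulrA ler_pM2l// -powRD; last first.
  by rewrite (gt_eqF (denomR_gt0 k)) implybT.
rewrite -powR_inv1 ?ler0n// ler_powR//; lra.
Qed.

Lemma thin_set_null (s : R) : 1 / 2 < s ->
  hausdorff_measure (fun x : R => x `^ s) thin_set = 0%E.
Proof.
move=> s12; have s0 : 0 < s by lra.
have content_ge0 (delta : R) :
    (0 <= hausdorff_content (fun x : R => (x `^ s)%R) delta thin_set)%E.
  by apply: hausdorff_content_ge0 => t _; exact: powR_ge0.
apply/eqP; rewrite eq_le; apply/andP; split; last first.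
  apply: le_trans (content_ge0 1) _; apply: ereal_sup_ubound.
  by exists 1 => //=.
apply: ge_ereal_sup => _ [delta /= delta0 <-].
apply/lee_addgt0Pr => eps eps0; rewrite add0e.
(* Beyond three thresholds: for the diameter, the content and the exponent. *)
pose k := (Num.truncn delta^-1 + Num.truncn (28 / eps)
            + Num.truncn (4 / (2 * s - 1))).+1.
have large (x : R) : (Num.truncn x < k)%N -> x < k%:R.
  by move=> xk; apply: (lt_le_trans (truncnS_gt x)); rewrite ler_nat.
have /large kdelta : (Num.truncn delta^-1 < k)%N.
  by rewrite ltnS -addnA leq_addr.
have /large keps : (Num.truncn (28 / eps) < k)%N.
  by rewrite ltnS addnAC leq_addl.
have /large ks : (Num.truncn (4 / (2 * s - 1)) < k)%N by rewrite ltnS leq_addl.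
have kq : k%:R <= (denom k)%:R :> R by rewrite ler_nat ltnW ?denom_gt.
have q0 := @denomR_gt0 R k.
apply: (le_trans (@thin_set_content s delta k s0 _ _)).
- rewrite -[delta]invrK ltf_pV2 ?posrE ?invr_gt0//; lra.
- by move: ks; rewrite ltr_pdivrMr; lra.
- rewrite lee_fin ler_pdivrMr// mulrC -ler_pdivrMr//; lra.
Qed.

Lemma thin_set_dim : (hausdorff_dim thin_set <= (1 / 2)%:E)%E.
Proof.
apply/lee_addgt0Pr => eps eps0; rewrite -EFinD.
apply: ereal_inf_lbound; exists (1 / 2 + eps) => //; split; first by lra.
by apply: thin_set_null; lra.
Qed.

Lemma unit_vector_slope e : euclidean_norm e = 1 ->
  exists o, e 0 o != 0 /\ [/\ `|e 0 o| <= 1, 1 / 2 <= `|e 0 o| &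
    `|e 0 (o + 1) / e 0 o| <= 1].
Proof.
move=> e1.
have large o : `|e 0 (o + 1)| <= `|e 0 o| ->
    e 0 o != 0 /\ [/\ `|e 0 o| <= 1, 1 / 2 <= `|e 0 o| &
      `|e 0 (o + 1) / e 0 o| <= 1].
  move=> oo; have half : 1 / 2 <= `|e 0 o|.
    have : e 0 o ^+ 2 + e 0 (o + 1) ^+ 2 = 1.
      rewrite -[LHS]sqr_sqrtr ?addr_ge0 ?sqr_ge0//.
      by rewrite -euclidean_norm2 e1 expr1n.
    rewrite -[e 0 o ^+ 2]real_normK ?num_real//.
    rewrite -[_ (o + 1) ^+ 2]real_normK ?num_real//.
    have := normr_ge0 (e 0 o); have := normr_ge0 (e 0 (o + 1)).
    nra.
  have eo0 : 0 < `|e 0 o| by lra.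
  split; first by rewrite -normr_gt0.
  split=> //; first by rewrite -e1 coord_le_norm.
  by rewrite normrM normfV ler_pdivrMr// mul1r.
have [le01|/ltW le10] := lerP `|e 0 (0 + 1)| `|e 0 0|.
  by exists 0; exact: large.
exists 1; apply: large; move: le10; rewrite add0r.
by rewrite (_ : 1 + 1 = 0)//; apply: val_inj.
Qed.

Lemma thin_set_furstenberg (h : R -> R) :
  dimension_function h -> extends_log_gauge h -> furstenberg_set h thin_set.
Proof.
move=> [hge0 hle _ _] hlog e e1.
have [ o [eo0 [eo1 eo12 slope1]]] := unit_vector_slope _ e1.
pose s := e 0 (o + 1) / e 0 o.
have [b lines] := exists_lattice_line _ slope1.
have [c c0 hc] := log_gauge_dyadic _ _ hlog hle.
have oo : (o + 1 == o) = false.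
  by apply/negbTE; rewrite -subr_eq0 addrAC subrr add0r.
pose a : 'rV[R]_2 := \row_i (if i == o then 0 else b).
(* The point with abscissa [cantor u] on the line [y = b + s x]. *)
pose P u := a + (cantor u / e 0 o) *: e.
have Po u : P u 0 o = cantor u by rewrite !mxE eqxx add0r divfK.
have Poo u : P u 0 (o + 1) = b + s * cantor u.
  by rewrite !mxE oo /s; field.
(* Abscissas in [0, 1] correspond to parameters [t] with [`|t| <= 2] on the
   line, as [`|e 0 o| >= 1 / 2]; the segment is symmetric because [e 0 o] may
   be negative. *)
exists (a - 2 *: e), 4; split => //.
(* The constant [9] bounds the exponent [8 * cells k + 1] by [9 * cells k]. *)
apply: (@mass_distribution _ _ h P (c / 9)) => //; first by rewrite divr_gt0.
- move=> u /andP[u0 u1]; have /andP[cu0 cu1] := cantor_itv u0; split.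
    exists (2 + cantor u / e 0 o); last first.
      by rewrite /P [(2 + _) *: e]scalerDl addrA subrK.
    rewrite /= in_itv /=.
    have : `|cantor u / e 0 o| <= 2.
      by rewrite normrM normfV ler_pdivrMr ?normr_gt0// ger0_norm//; lra.
    by rewrite ler_norml => *; lra.
  move=> k; have [p pq up] := cantor_fibre k u0.
  have [z zN [xr yr]] := near_node slope1 lines pq cu1 up.
  by exists o, p, z; split=> //; split; rewrite ?Po ?Poo.
- move=> u v u01 v01; have [->|uv] := eqVneq u v.
    by rewrite subrr normr0 mulr0 hge0 ?euclidean_norm_ge0.
  have [k [uvk sep]] := cantor_separated u01 v01 uv.
  apply: (@le_trans _ _ (h (2 ^- (8 * cells k).+1))).
    apply: le_trans (hc _ _); last by [].
    have N1 : 1 <= (cells k)%:R :> R.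
      by rewrite ler1n (leq_ltn_trans _ (leq_cells k)).
    have -> : (8 * cells k).+1%:R = 8 * (cells k)%:R + 1 :> R.
      by rewrite -natr1 natrM.
    apply: (@le_trans _ _ (c / 9 * (cells k)%:R^-1)).
      by rewrite ler_pM2l// divr_gt0.
    rewrite -mulrA -invfM ler_pM2l// lef_pV2 ?posrE; lra.
  apply: hle; first by rewrite invr_ge0 exprn_ge0.
  apply: (le_trans sep); apply: le_trans (coord_le_norm o _).
  by rewrite [(P u - P v) 0 o]mxE [(- P v) 0 o]mxE !Po.
Qed.

End ThinSet.

Theorem theorem3p3 (R : realType) (h : R -> R)
    (h_dim : dimension_function h) (h_log : extends_log_gauge h) :
  exists E : set 'rV[R]_2,
    furstenberg_set h E /\ (hausdorff_dim E <= (1 / 2)%:E)%E.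
Proof.
by exists thin_set; split; [exact: thin_set_furstenberg | exact: thin_set_dim].
Qed.
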